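(* Let $(X,d)$ be a compact metric space and let $\nu$ be an additive non-negative set function with $\nu(X)=1$ defined on the Borel sets of $X$. Then for every $\epsilon>0$ $$\frac{1}{h_+(\nu;2\epsilon)}\ \le\ M(\epsilon)\ \le\ \frac{1}{h_-(\nu;\epsilon)} .$$
   Context: $B(x,r)=\{y\in X:d(x,y)\le r\}$ is the closed ball. $h_-(\nu;r)=\inf_{x\in X}\nu(B(x,r))$ and $h_+(\nu;r)=\sup_{x\in X}\nu(B(x,r))$. $M(\epsilon)=M(X,d,\epsilon)$ (the capacity of $X$) is the maximal number of pairwise disjoint balls $B(y_l,\epsilon)$ with centers $y_l\in X$. The convention $1/0=+\infty$ is used. *)

(* Defs.v *)
From mathcomp Require Import all_boot all_order all_algebra.
From mathcomp Require Import finmap.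
From mathcomp Require Import all_classical all_reals all_analysis.

Set Implicit Arguments.
Unset Strict Implicit.
Unset Printing Implicit Defensive.

Import Order.TTheory GRing.Theory Num.Theory.

Local Open Scope classical_set_scope.
Local Open Scope ring_scope.

(* Not the library's [closed_ball], which is the closure of the open ball and
   can be smaller in a general metric space. *)
Definition cball (R : realType) (X : metricType R) (x : X) (r : R) : set X :=
  [set y | mdist x y <= r].

Definition borel (T : topologicalType) : set (set T) := <<s @open T >>.

Definition hminus (R : realType) (X : metricType R) (nu : set X -> \bar R)
  (r : R) : \bar R := ereal_inf (range (fun x : X => nu (cball x r))).

Definition hplus (R : realType) (X : metricType R) (nu : set X -> \bar R)
  (r : R) : \bar R := ereal_sup (range (fun x : X => nu (cball x r))).

Definition packing (R : realType) (X : metricType R) (eps : R) (n : nat)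
  (y : 'I_n -> X) : Prop := trivIset setT (fun l => cball (y l) eps).

(* In a compact space the supremum is a maximum and a natural number, see
   [capacity_max] below. *)
Definition capacity (R : realType) (X : metricType R) (eps : R) : \bar R :=
  ereal_sup [set (n%:R%:E : \bar R) | n in
    [set n : nat | exists y : 'I_n -> X, packing eps y]].

Lemma packing_bounded (R : realType) (X : metricType R) (eps : R) :
    compact [set: X] -> 0 < eps ->
  exists N : nat, forall (n : nat) (y : 'I_n -> X),
    packing eps y -> (n <= N)%N.
Proof.
move=> cX eps0.
pose F : set_system {fset X} :=
  [set S | exists D0 : {fset X}, forall D, (D0 `<=` D)%fset -> S D].
have FF : Filter F.
  split; first by exists fset0.
  - move=> P Q [D PD] [E QE]; exists (D `|` E)%fset => G.
    by rewrite fsubUset => /andP[/PD PG /QE QG].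
  - by move=> P Q PQ [D PD]; exists D => G /PD /PQ.
pose P (D : {fset X}) (x : X) := exists2 c, c \in D & ball c eps x.
have [|D /(_ _ (fsubset_refl D)) DX] :=
    (compact_near_coveringP _).1 cX _ F P FF.
  move=> x _; exists (ball x eps, [set D | x \in D]).
    split; first exact: nbhsx_ballx.
    by exists [fset x]%fset => D; rewrite fsub1set.
  by move=> [y D] [/= xy xD]; exists x.
exists #|{: D}| => n y py.
have /choice[c cP] : forall l : 'I_n, exists c : D, ball (val c) eps (y l).
  by move=> l; have [x xD xy] := DX (y l) I; exists [` xD]%fset.
rewrite -[leqLHS]card_ord; apply: (@leq_card _ _ c) => i j cij.
apply: (py i j) => //; exists (val (c i)); split; rewrite /cball/= metric_sym.
  by have := cP i; rewrite ballEmdist/= => /ltW.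
by have := cP j; rewrite -cij ballEmdist/= => /ltW.
Qed.

Lemma capacity_max (R : realType) (X : metricType R) (eps : R) :
    compact [set: X] -> 0 < eps ->
  exists M : nat, [/\ capacity X eps = M%:R%:E,
    exists y : 'I_M -> X, packing eps y &
    forall (n : nat) (y : 'I_n -> X), packing eps y -> (n <= M)%N].
Proof.
move=> cX eps0; have [N NP] := packing_bounded cX eps0.
pose P (n : nat) := `[< exists y : 'I_n -> X, packing eps y >].
have exP : exists n, P n.
  exists 0%N; apply/asboolP.
  have y0 : 'I_0 -> X by case.
  by exists y0 => -[].
have ubP n : P n -> (n <= N)%N by move=> /asboolP[y /NP].
case: (ex_maxnP exP ubP) => M /asboolP[y py] Mmax; exists M.
have max n (z : 'I_n -> X) : packing eps z -> (n <= M)%N.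
  by move=> pz; apply: Mmax; apply/asboolP; exists z.
split=> //; last by exists y.
apply/eqP; rewrite eq_le; apply/andP; split.
  by apply: ge_ereal_sup => _ [n [z /max nM] <-]; rewrite lee_fin ler_nat.
by apply: ereal_sup_ubound; exists M => //; exists y.
Qed.

(* Main.v *)
Require Import Defs.
From mathcomp Require Import all_boot all_order all_algebra.
From mathcomp Require Import all_classical all_reals all_analysis.

Set Implicit Arguments.
Unset Strict Implicit.
Unset Printing Implicit Defensive.

Import Order.TTheory GRing.Theory Num.Theory.

Local Open Scope classical_set_scope.
Local Open Scope ereal_scope.

(** Write M for the capacity at scale eps, attained by a packing y_1, ..., y_M.

    Upper bound: the balls B(y_l, eps) are disjoint, so the sum of their masses
    is the mass of their union, hence at most nu(X) = 1; each of them has mass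
    at least h_-(eps), so M h_-(eps) <= 1 ([capacity_hminus_le1]).

    Lower bound: no further ball of radius eps can be added to a packing of
    maximal size, so for every x the ball B(x, eps) meets some B(y_l, eps), and
    the triangle inequality puts x in B(y_l, 2 eps).  Thus the balls of the
    doubled radius cover X ([maximal_packing_cover]), and subadditivity gives
    1 = nu(X) <= M h_+(2 eps) ([capacity_hplus_ge1]). *)

Definition borel_content (T : topologicalType) (R : realType)
    (nu : set T -> \bar R) : Prop :=
  (forall A, borel A -> 0 <= nu A) /\
  (forall A B, borel A -> borel B -> A `&` B = set0 ->
     nu (A `|` B) = nu A + nu B).

Lemma borelT (T : topologicalType) : borel [set: T].
Proof. by apply: sub_sigma_algebra; exact: openT. Qed.

Lemma borel0 (T : topologicalType) : borel (set0 : set T).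
Proof. exact: sigma_algebra0. Qed.

Lemma borelC (T : topologicalType) (A : set T) : borel A -> borel (~` A).
Proof. by rewrite -setTD; exact: sigma_algebraCD. Qed.

Lemma borelU (T : topologicalType) (A B : set T) :
  borel A -> borel B -> borel (A `|` B).
Proof.
move=> bA bB; rewrite -bigcup2E; apply: sigma_algebra_bigcup => -[|[|n]] //=.
exact: borel0.
Qed.

Lemma borelD (T : topologicalType) (A B : set T) :
  borel A -> borel B -> borel (A `\` B).
Proof.
move=> bA bB; rewrite setDE -[A `&` _]setCK setCI setCK.
by apply: borelC; apply: borelU => //; exact: borelC.
Qed.

Lemma borel_bigU (T : topologicalType) (I : choiceType) (r : seq I)
    (A : I -> set T) :
  (forall i, borel (A i)) -> borel (\big[setU/set0]_(i <- r) A i).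
Proof. by move=> bA; apply: big_ind => //; [exact: borel0|exact: borelU]. Qed.

(** The complement is open: a point at distance more than r from x stays so
    when moved by less than the excess. *)
Lemma borel_cball (R : realType) (X : metricType R) (x : X) (r : R) :
  borel (cball x r).
Proof.
rewrite -[cball x r]setCK; apply: borelC; apply: sub_sigma_algebra.
rewrite openE => y /= /negP; rewrite -ltNge => rxy.
have e_gt0 : (0 < mdist x y - r)%R by rewrite subr_gt0.
apply: filterS (nbhsx_ballx y _ e_gt0) => z; rewrite ballEmdist/= => yz.
apply/negP; rewrite -ltNge; have := metric_triangle x z y.
rewrite (metric_sym z y) => xy; rewrite -(ltrD2r (mdist y z)).
by apply: lt_le_trans xy; rewrite addrC -ltrBrDr.
Qed.

Section borel_content_theory.
Context {T : topologicalType} {R : realType} {nu : set T -> \bar R}.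
Hypothesis nuP : borel_content nu.

Lemma content_le (A B : set T) :
  borel A -> borel B -> A `<=` B -> nu A <= nu B.
Proof.
case: nuP => nu_ge0 nuU bA bB AB.
rewrite -(setDUK AB) nuU ?setDIK//; last exact: borelD.
by rewrite leeDl// nu_ge0//; exact: borelD.
Qed.

Lemma content_setU_le (A B : set T) :
  borel A -> borel B -> nu (A `|` B) <= nu A + nu B.
Proof.
case: nuP => nu_ge0 nuU bA bB.
rewrite -(setDUK (@subsetUl _ A B)) setDUl setDv set0U.
rewrite nuU ?setDIK//; last exact: borelD.
by rewrite leeD2l// content_le//; exact: borelD.
Qed.

(** Additivity alone leaves room for infinite mass on every set, the empty one
    included; cancelling the finite total mass rules this out. *)
Lemma content0 : nu setT = 1 -> nu set0 = 0.
Proof.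
case: nuP => nu_ge0 nuU nuT.
have := nuU _ _ (@borelT T) (@borel0 T) (setI0 _).
rewrite setU0 nuT; case: (nu set0) => //= s [].
by rewrite -[X in X = _]addr0 => /addrI <-.
Qed.

Lemma content_bigU_le (I : choiceType) (r : seq I) (A : I -> set T) :
    nu set0 = 0 -> (forall i, borel (A i)) ->
  nu (\big[setU/set0]_(i <- r) A i) <= \sum_(i <- r) nu (A i).
Proof.
move=> nu0 bA; elim: r => [|i r IHr]; first by rewrite !big_nil nu0.
rewrite !big_cons; apply: le_trans (leeD2l _ IHr).
by apply: content_setU_le => //; exact: borel_bigU.
Qed.

Lemma content_bigU (I : choiceType) (r : seq I) (A : I -> set T) :
    nu set0 = 0 -> (forall i, borel (A i)) -> uniq r -> trivIset setT A ->
  nu (\big[setU/set0]_(i <- r) A i) = \sum_(i <- r) nu (A i).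
Proof.
move=> nu0 bA + tA; elim: r => [|i r IHr]; first by rewrite !big_nil nu0.
move=> /= /andP[ir ur]; rewrite !big_cons nuP.2 ?IHr//; first exact: borel_bigU.
rewrite -bigcup_seq; apply/seteqP; split=> // x [Aix [j /= jr Ajx]].
have ij : i = j by apply: tA => //; exists x.
by rewrite ij jr in ir.
Qed.

End borel_content_theory.

(** If x were at distance more than 2 eps from every center, its eps-ball would
    be disjoint from the others and would extend the packing. *)
Lemma maximal_packing_cover (R : realType) (X : metricType R) (eps : R)
    (n : nat) (y : 'I_n -> X) :
    packing eps y ->
    (forall (m : nat) (z : 'I_m -> X), packing eps z -> (m <= n)%N) ->
  \big[setU/set0]_(l <- enum 'I_n) cball (y l) (2 * eps)%R = setT.
Proof.
move=> py n_max; rewrite -bigcup_seq.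
apply/seteqP; split=> // x _; apply: contrapT => x_far.
pose z (i : 'I_n.+1) := if unlift ord0 i is Some l then y l else x.
have disj l u : cball x eps u -> cball (y l) eps u -> False.
  move=> xu yu; apply: x_far; exists l; first by rewrite /= mem_enum.
  rewrite /cball/= (le_trans (metric_triangle _ u _))//.
  by rewrite mulrDl mul1r lerD// metric_sym.
suff /n_max : packing eps z by rewrite ltnn.
move=> i j _ _ [u []]; rewrite /z.
case: unliftP => [k|] ->; case: unliftP => [l|] -> //.
- by move=> ku lu; rewrite (py k l)//; exists u.
- by move=> ku xu; case: (disj k u).
- by move=> xu lu; case: (disj l u).
Qed.

Section capacity_bounds.
Context {R : realType} {X : metricType R} {nu : set X -> \bar R}.
Hypothesis nuP : borel_content nu.
Hypothesis nuT : nu setT = 1.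

Lemma capacity_hminus_le1 (eps : R) (n : nat) (y : 'I_n -> X) :
  packing eps y -> n%:R%:E * hminus nu eps <= 1.
Proof.
move=> py.
have -> : n%:R%:E * hminus nu eps = \sum_(l <- enum 'I_n) hminus nu eps.
  by rewrite big_enum sumr_const card_ord mule_natl.
apply: (@le_trans _ _ (\sum_(l <- enum 'I_n) nu (cball (y l) eps))).
  by apply: lee_sum => l _; apply: ereal_inf_lbound; exists (y l).
have bB l : borel (cball (y l) eps) by exact: borel_cball.
rewrite -(content_bigU nuP) ?enum_uniq//; last exact: content0.
rewrite -nuT (content_le nuP)//; last exact: borelT.
exact: borel_bigU.
Qed.

Lemma capacity_hplus_ge1 (eps : R) (n : nat) (y : 'I_n -> X) :
    packing eps y ->
    (forall (m : nat) (z : 'I_m -> X), packing eps z -> (m <= n)%N) ->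
  1 <= n%:R%:E * hplus nu (2 * eps)%R.
Proof.
move=> py n_max.
rewrite -nuT -(maximal_packing_cover py n_max).
have bB l : borel (cball (y l) (2 * eps)) by exact: borel_cball.
apply: (le_trans (content_bigU_le nuP _ (content0 nuP nuT) bB)).
have -> : n%:R%:E * hplus nu (2 * eps)%R
          = \sum_(l <- enum 'I_n) hplus nu (2 * eps)%R.
  by rewrite big_enum sumr_const card_ord mule_natl.
by apply: lee_sum => l _; apply: ereal_sup_ubound; exists (y l).
Qed.

End capacity_bounds.

(** For h = 0 the right-hand side is infinite, and for h infinite the
    hypothesis forces n = 0. *)
Lemma nat_le_div1e (R : realType) (n : nat) (h : \bar R) :
  0 <= h -> n%:R%:E * h <= 1 -> n%:R%:E <= 1 / h.
Proof.
case: h => [r| |] //.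
  rewrite lee_fin le_eqVlt => /predU1P[<- _|r_gt0].
    by rewrite inve0 mul1e leey.
  by rewrite -EFinM inver gt_eqF// mul1e !lee_fin -div1r ler_pdivlMr.
by case: n => [|n] _; rewrite ?invey ?mule0// gt0_muley ?lte_fin ?ltr0n.
Qed.

(** Since n is nonnegative, n h >= 1 forces h > 0, so the quotient is finite. *)
Lemma div1e_le_nat (R : realType) (n : nat) (h : \bar R) :
  1 <= n%:R%:E * h -> 1 / h <= n%:R%:E.
Proof.
move=> nh; have h_gt0 : 0 < h.
  rewrite ltNge; apply/negP => h_le0; move: nh; apply/negP; rewrite -ltNge.
  by rewrite (le_lt_trans (mule_ge0_le0 _ h_le0))// lee_fin.
case: h nh h_gt0 => [r| |] //; last by rewrite invey mule0 lee_fin.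
rewrite lte_fin => + r_gt0.
by rewrite -EFinM inver gt_eqF// mul1e !lee_fin -div1r ler_pdivrMr.
Qed.

Theorem proposition3p1 (R : realType) (X : metricType R)
    (nu : set X -> \bar R) (cX : compact [set: X])
    (nu_ge0 : forall A : set X, borel A -> 0 <= nu A)
    (nu_additive : forall A B : set X, borel A -> borel B ->
       A `&` B = set0 -> nu (A `|` B) = nu A + nu B)
    (nuT : nu [set: X] = 1)
    (eps : R) (eps_gt0 : (0 < eps)%R) :
  1 / hplus nu (2 * eps)%R <= capacity X eps /\
  capacity X eps <= 1 / hminus nu eps.
Proof.
have nuP : borel_content nu by [].
have [M [-> [y py] M_max]] := capacity_max cX eps_gt0.
split; first exact: div1e_le_nat (capacity_hplus_ge1 nuP nuT py M_max).
apply: nat_le_div1e; last exact: (capacity_hminus_le1 nuP nuT py).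
by apply: le_ereal_inf_tmp => _ [x _ <-]; apply: nu_ge0; exact: borel_cball.
Qed.
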